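(* Let $n\ge1$, and call two permutations in $\mathcal{S}_n$ equivalent if they have the same image under the mapping $\mathbb{M}$ defined in the context. Then the map $\mathbb{B}$ sending each equivalence class $\mathbf{E}_p=\{\pi\in\mathcal{S}_n:\mathbb{M}(\pi)=p\}$ to the path $p$ is a bijection from the set of equivalence classes of permutations to the set of weighted bicoloured Motzkin paths of length $n$ (with no $F$ step at height $0$), where a step starting at height $h$ has weight \[ N_h=E_h=[h+1]^x_q,\qquad S_h=F_h=[h]_q \] and the weight of a path is the product of the weights of its steps; and for every equivalence class $\mathbf{E}$ the sum of the weights of the permutations in $\mathbf{E}$ equals the weight of $\mathbb{B}(\mathbf{E})$.
   Context: **Notation.** $[0]_q=0$, and for $h\ge1$: $[h]_q=1+q+\dots+q^{h-1}$, $[h]^x_q=1+q+\dots+q^{h-2}+xq^{h-1}$ (so $[1]^x_q=x$). $\mathcal{S}_n$ is the set of permutations of $\{1,\dots,n\}$. **Bicoloured Motzkin paths.** A Motzkin path of length $n$ is a sequence $(v_0,\dots,v_n)$ of points of $\mathbb{N}^2$ ($\mathbb{N}=\{0,1,\dots\}$) with $v_0=(0,0)$, $v_n=(n,0)$ and each step in $\{(1,1),(1,-1),(1,0)\}$. It is bicoloured if each $(1,0)$ step has one of two colours. Write $N$ for $(1,1)$, $S$ for $(1,-1)$, and $E$, $F$ for $(1,0)$ steps of the two colours. The height of a step is the second coordinate of its starting point; $N_h,S_h,E_h,F_h$ denote the weight of a step of the given type starting at height $h$. **Standard cycle form.** For $\pi\in\mathcal{S}_n$, $C(\pi)=(c^1_1\cdots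 c^1_{i_1})\cdots(c^k_1\cdots c^k_{i_k})$ is the cycle decomposition (fixed points included), each cycle written starting with its smallest element, cycles listed in decreasing order of their smallest elements; $(c_1c_2\cdots c_m)$ means $c_1\mapsto c_2\mapsto\cdots\mapsto c_m\mapsto c_1$. **Arc representation and shapes.** Put nodes $1,\dots,n$ on a line from left to right. For each cycle $s$ and $1\le t\le i_s-1$ draw an arc directed from node $c^s_t$ to node $c^s_{t+1}$ (no arc from the last element back to the first); for a cycle of size 1 draw a loop. The left shape $l_k$ (right shape $r_k$) of node $k$ records the non-loop arcs joining $k$ to nodes on its left (right), each drawn as an arrow in its direction of travel: $\emptyset$ if none, $\rightarrow$ if one arc directed from left to right, $\leftarrow$ if one arc directed from right to left, $\rightleftharpoons$ if two arcs, one in each direction. A node with a loop has shape pair $(\emptyset,\emptyset)$. **The mapping $\mathbb{M}$.** $\mathbb{M}(\pi)$ is the (unweighted) path with steps $s_1,\dots,s_n$ where $s_k$ depends on $(l_k,r_k)$: $(\emptyset,\emptyset)\mapsto E$; $(\emptyset,\rightarrow)\mapsto N$; $(\emptyset,\leftarrow)\mapsto F$; $(\emptyset,\rightleftharpoons)\mapsto N$; $(\rightarrow,\emptyset)\mapsto S$; $(\rightarrow,\rightarrow)\mapsto E$; $(\leftarrow,\leftarrow)\mapsto F$; $(\rightleftharpoons,\emptyset)\mapsto S$. No other shape pairs occur. **Weights of permutations.** Imagine the arcs of $\pi$ drawn in the order in which they occur in $C(\pi)$, reading from left to right. Node $k$ has weight $x^aq^{b+w}$, where $a=1$ if $k$ is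 the first (smallest) element of its cycle and $a=0$ otherwise; $b$ (resp. $w$) is the number of arcs belonging to a different cycle than $k$ (resp. the same cycle as $k$), drawn after node $k$ is visited, that pass over node $k$ from left to right, i.e. are directed from a node $u$ to a node $v$ with $u<k<v$. The weight of $\pi$ is the product of the weights of its nodes. *)

(* Defs.v *)
From HB Require Import structures.
From mathcomp Require Import all_boot all_order all_algebra all_fingroup.

Set Implicit Arguments.
Unset Strict Implicit.
Unset Printing Implicit Defensive.

Import Order.TTheory GRing.Theory Num.Theory.
Local Open Scope ring_scope.

(* The set {1, ..., n} is rendered as 'I_n, so i : 'I_n stands for the node
   i + 1; only the order of the nodes matters below.                          *)

(** * q-integers *)

Definition qint (R : comNzRingType) (q : R) (h : nat) : R :=
  \sum_(i < h) q ^+ i.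

(* The value at h = 0 is a convention; only h >= 1 is used. *)
Definition qintx (R : comNzRingType) (x q : R) (h : nat) : R :=
  if h is h'.+1 then \sum_(i < h') q ^+ i + x * q ^+ h' else 0.

(** * Bicoloured Motzkin paths *)

(* StepE and StepF are the two colours of the horizontal step. *)
Inductive step := StepN | StepS | StepE | StepF.

Definition step_code (a : step) : bool * bool :=
  match a with
  | StepN => (true, true)
  | StepS => (true, false)
  | StepE => (false, true)
  | StepF => (false, false)
  end.

Definition step_decode (c : bool * bool) : step :=
  match c with
  | (true, true) => StepN
  | (true, false) => StepS
  | (false, true) => StepE
  | (false, false) => StepF
  end.

Lemma step_codeK : cancel step_code step_decode.
Proof. by case. Qed.

HB.instance Definition _ := Finite.copy step (can_type step_codeK).

Definition step_vec (a : step) : int * int :=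
  match a with
  | StepN => (1, 1)
  | StepS => (1, -1)
  | StepE | StepF => (1, 0)
  end.

(* A path starting at (0, 0) is given by its coloured steps.  Its vertices v_k
   live in int * int, so that membership in N^2 is a condition on the path.   *)
Definition vertex (p : seq step) (k : nat) : int * int :=
  \sum_(a <- take k p) step_vec a.

Definition motzkin (n : nat) (p : n.-tuple step) : bool :=
  [forall k : 'I_n.+1, (0 <= (vertex p k).1) && (0 <= (vertex p k).2)]
  && (vertex p n == (n%:Z, 0)).

(* The height of step number k (counted from 0), which starts at v_k.  The
   absolute value is the identity on Motzkin paths.                           *)
Definition height (p : seq step) (k : nat) : nat := `|(vertex p k).2|%N.

Definition no_F_at_0 (n : nat) (p : n.-tuple step) : bool :=
  [forall k : 'I_n, (tnth p k == StepF) ==> (height p k != 0%N)].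

Definition motzkin_paths (n : nat) : {set n.-tuple step} :=
  [set p | motzkin p && no_F_at_0 p].

Definition step_weight (R : comNzRingType) (x q : R) (a : step) (h : nat) : R :=
  match a with
  | StepN | StepE => qintx x q h.+1
  | StepS | StepF => qint q h
  end.

Definition path_weight (R : comNzRingType) (x q : R) (n : nat)
    (p : n.-tuple step) : R :=
  \prod_(k < n) step_weight x q (tnth p k) (height p k).

(** * Standard cycle form *)

Definition cycle_min (n : nat) (s : 'S_n) (i : 'I_n) : bool :=
  [forall j in porbit s i, (i <= j)%N].

(* traject s m #|porbit s m| is the sequence m, s m, s (s m), ... running once
   around the cycle of m; enum 'I_n is increasing.                            *)
Definition cycle_form (n : nat) (s : 'S_n) : seq (seq 'I_n) :=
  [seq traject s m #|porbit s m| | m <- rev (enum 'I_n) & cycle_min s m].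

(** * Arcs and shapes *)

(* The non-loop arcs (u, v), directed from u to v, in the order in which they
   are drawn.  The loops at fixed points contribute neither to the shapes nor
   to the arcs passing over a node, so they are left out.                     *)
Definition arcs (n : nat) (s : 'S_n) : seq ('I_n * 'I_n) :=
  flatten [seq zip c (behead c) | c <- cycle_form s].

(* No arrow; left to right; right to left; one arrow in each direction. *)
Inductive arrows := ArrNone | ArrR | ArrL | ArrRL.

Definition arrows_of (to_right to_left : bool) : arrows :=
  match to_right, to_left with
  | false, false => ArrNone
  | true, false => ArrR
  | false, true => ArrL
  | true, true => ArrRL
  end.

Definition left_shape (n : nat) (s : 'S_n) (k : 'I_n) : arrows :=
  arrows_of [exists u : 'I_n, (u < k)%N && ((u, k) \in arcs s)]
            [exists u : 'I_n, (u < k)%N && ((k, u) \in arcs s)].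

Definition right_shape (n : nat) (s : 'S_n) (k : 'I_n) : arrows :=
  arrows_of [exists v : 'I_n, (k < v)%N && ((k, v) \in arcs s)]
            [exists v : 'I_n, (k < v)%N && ((v, k) \in arcs s)].

(* The last case is junk: the remaining pairs are not realised by a
   permutation.                                                               *)
Definition step_of_shapes (l r : arrows) : step :=
  match l, r with
  | ArrNone, ArrNone => StepE
  | ArrNone, ArrR => StepN
  | ArrNone, ArrL => StepF
  | ArrNone, ArrRL => StepN
  | ArrR, ArrNone => StepS
  | ArrR, ArrR => StepE
  | ArrL, ArrL => StepF
  | ArrRL, ArrNone => StepS
  | _, _ => StepE
  end.

Definition mapM (n : nat) (s : 'S_n) : n.-tuple step :=
  [tuple step_of_shapes (left_shape s k) (right_shape s k) | k < n].

(** * Weights of permutations *)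

(* Arcs are drawn while reading the word obtained by concatenating the cycles;
   the arc (u, v) is drawn when leaving u, hence after the visit of k exactly
   when u does not occur before k in that word.                               *)
Definition passes_after (n : nat) (s : 'S_n) (k : 'I_n) (e : 'I_n * 'I_n)
    : bool :=
  let word := flatten (cycle_form s) in
  [&& (e.1 < k)%N, (k < e.2)%N & (index k word <= index e.1 word)%N].

(* The two ends of an arc lie in the same cycle, so e.1 determines the cycle
   the arc e belongs to.                                                      *)
Definition arcs_over_diff (n : nat) (s : 'S_n) (k : 'I_n) : nat :=
  count (fun e => passes_after s k e && (e.1 \notin porbit s k)) (arcs s).

Definition arcs_over_same (n : nat) (s : 'S_n) (k : 'I_n) : nat :=
  count (fun e => passes_after s k e && (e.1 \in porbit s k)) (arcs s).

Definition node_weight (R : comNzRingType) (x q : R) (n : nat) (s : 'S_n)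
    (k : 'I_n) : R :=
  x ^+ cycle_min s k * q ^+ (arcs_over_diff s k + arcs_over_same s k).

Definition perm_weight (R : comNzRingType) (x q : R) (n : nat) (s : 'S_n) : R :=
  \prod_(k < n) node_weight x q s k.

(** * Equivalence classes and the map B *)

Definition Mequiv (n : nat) : rel 'S_n := fun s t => mapM s == mapM t.

Definition Mclasses (n : nat) : {set {set 'S_n}} :=
  equivalence_partition (@Mequiv n) [set: 'S_n].

Definition Mclass (n : nat) (p : n.-tuple step) : {set 'S_n} :=
  [set s | mapM s == p].

(* repr C is an element of C whenever C is nonempty, so that mapB C is the
   common image under mapM of the elements of the class C.                    *)
Definition mapB (n : nat) (C : {set 'S_n}) : n.-tuple step := mapM (repr C).

(* Main.v *)
Require Import Defs.
From HB Require Import structures.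
From mathcomp Require Import all_boot all_order all_algebra all_fingroup.
From mathcomp Require Import zify.

Import Order.TTheory GRing.Theory Num.Theory.

(** Write the standard cycle form of a permutation without its parentheses.
The result is a word in the nodes, and since cycles start with their minima,
which decrease from cycle to cycle, the cycle starts are exactly the
left-to-right minima of the word; hence the parentheses can be put back
([word_inj]), and this is a bijection onto the words with letters 1, ..., n
([nword_surj]).

Everything in the theorem is local in this word.  With an infinite letter
placed before the word and a letter 0 after it, a node is sent to N, S, E or F
according as its letter is a valley, a peak, a double ascent or a double
descent, except that a double descent which is a left-to-right minimum gives
E: no arc enters the start of a cycle ([nword_step]).  A node carries x when
its letter is a left-to-right minimum ([nword_lrmin]), and its power of q
counts the adjacent pairs u v to its right with u < k < v ([nword_crossings]).

It remains to build words by inserting the letters in increasing order,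
keeping track only of the blocks which the letters already present form in the
final word; the final 0 belongs to the last block.  This is recorded by
[profile]: the letters at most k in the order of the word, each with a bit
saying whether it starts a block.  The number of blocks is one plus the height
of the path ([vertex2_mapM]).  Inserting k + 1 amounts to choosing a block,
putting k + 1 in front of it, and deciding two bits: whether k + 1 starts a
block and whether the chosen block still starts one ([profile_step]).  The two
bits give the type of the step, up to the choice between E and F.  If j blocks
follow the chosen one, the node of k + 1 has weight q^j, with a factor x
exactly when the chosen block is the first one, that is when j is the height
h.  The steps N and E allow j = 0, ..., h, whereas S and F exclude j = h, so
that the sum over j is the weight of the step ([step_weight_sum]).
Multiplying these sums along the path gives the sum over a class
([sum_class]).

That every path is reached follows from the same identity: over the integers,
at x = q = 1, the weight of a path staying at nonnegative height without F at
height 0 is nonzero, so the sum over its class is not empty ([mapM_onto]). *)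

(** * Sequences *)

Definition before (T : eqType) (m : T) (w : seq T) := take (index m w) w.
Definition after (T : eqType) (m : T) (w : seq T) := drop (index m w).+1 w.
Arguments before {T}.
Arguments after {T}.

Lemma before_cat (T : eqType) (m : T) (L R : seq T) :
  m \notin L -> before m (L ++ m :: R) = L.
Proof.
by move=> mL; rewrite /before index_cat (negPf mL) /= eqxx addn0 take_size_cat.
Qed.

Lemma after_cat (T : eqType) (m : T) (L R : seq T) :
  m \notin L -> after m (L ++ m :: R) = R.
Proof.
move=> mL; rewrite /after index_cat (negPf mL) /= eqxx addn0.
by rewrite -cat_rcons drop_size_cat // size_rcons.
Qed.

Lemma uniq_cat_cons (T : eqType) (m : T) (L R : seq T) :
  uniq (L ++ m :: R) -> m \notin L /\ m \notin R.
Proof.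
by rewrite cat_uniq /= negb_or => /and3P[_ /andP[mL _] /andP[mR _]].
Qed.

Lemma zip_behead_cat (T : Type) (u : T) (c w : seq T) :
  zip (u :: c ++ w) (c ++ w) = zip (u :: c) c ++ zip (last u c :: w) w.
Proof. by elim: c u => //= v c IH u; rewrite IH. Qed.

(** The adjacent pairs lost when a concatenation is cut into its pieces are
those ending at the head of a piece; if the heads are the only entries
satisfying [M], they are recognised by their second component. *)
Lemma filter_zip_flatten (T : Type) (M : pred T) (cs : seq (seq T)) :
    all (fun c => if c is m :: c' then M m && all (predC M) c' else false) cs ->
  flatten [seq zip c (behead c) | c <- cs] =
  [seq e <- zip (flatten cs) (behead (flatten cs)) | ~~ M e.2].
Proof.
elim: cs => //= -[|m c] //= cs IH /andP[/andP[Mm Mc] Mcs].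
rewrite zip_behead_cat filter_cat {}IH //; congr (_ ++ _).
  elim: c m {Mm} Mc => //= v c IH m /andP[-> /IH {1}->] //.
by case: cs Mcs => //= -[|m' c'] //= cs /andP[/andP[-> _] _].
Qed.

Lemma zip_traject (T : Type) (f : T -> T) (x : T) (N : nat) :
  zip (traject f x N) (behead (traject f x N)) =
  [seq (y, f y) | y <- traject f x N.-1].
Proof.
case: N => //= N.
by elim: N x => //= N IH x; rewrite IH.
Qed.

(** A key that does not occur on the left of the cut determines the cut. *)
Lemma split_key (T : Type) (K : eqType) (f : T -> K) (A A' B B' : seq T) x x' :
    A ++ x :: B = A' ++ x' :: B' -> f x = f x' ->
    f x \notin map f A -> f x' \notin map f A' ->
  [/\ A = A', x = x' & B = B'].
Proof.
move=> + fx; elim: A A' => [|a A IH] [|a' A'] //=; rewrite ?inE ?negb_or.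
- by move=> [-> ->].
- by move=> [Ex _] _ /andP[ne _]; rewrite -Ex fx eqxx in ne.
- by move=> [Ex _] /andP[ne _]; rewrite Ex fx eqxx in ne.
- by move=> [-> /IH{}IH] /andP[_ nA] /andP[_ nA']; have [-> -> ->] := IH nA nA'.
Qed.

Lemma zip_behead_split (T : Type) (k : T) (L R : seq T) :
  zip (L ++ k :: R) (behead (L ++ k :: R)) =
  zip L (rcons (behead L) k) ++ zip (k :: R) R.
Proof. by case: L => //= u L; elim: L u => //= v L IH u; rewrite IH. Qed.

Lemma zip_behead_rcons (T : Type) (u k : T) (L : seq T) :
  zip (u :: L) (rcons L k) = rcons (zip (u :: L) L) (last u L, k).
Proof. by elim: L u => //= v L IH u; rewrite IH. Qed.

Lemma zip_map_both (T U : Type) (f : T -> U) (w1 w2 : seq T) :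
  zip (map f w1) (map f w2) = [seq (f e.1, f e.2) | e <- zip w1 w2].
Proof. by elim: w1 w2 => [|a w1 IH] [|b w2] //=; rewrite IH. Qed.

Lemma mem_zip (T1 T2 : eqType) (w1 : seq T1) (w2 : seq T2) e :
  e \in zip w1 w2 -> e.1 \in w1 /\ e.2 \in w2.
Proof.
elim: w1 w2 => [|a w1 IH] [|b w2] //=.
rewrite !inE => /orP[/eqP-> /=|/IH[-> ->]]; rewrite ?eqxx ?orbT //.
Qed.

(** When the first bit is set, choosing the entry with most set bits to its
right is choosing the first entry. *)
Lemma nil_count_true (A T : seq (nat * bool)) v :
    head true (map snd (A ++ (v, true) :: T)) ->
  (A == [::]) = (count snd (A ++ (v, true) :: T) == (count snd T).+1).
Proof.
case: A => [|[u b] A] /=; first by rewrite add1n !eqxx.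
by move=> ->; rewrite count_cat -[LHS]/false; apply/esym/eqP => /=; lia.
Qed.

Lemma split_at_true (c : seq (nat * bool)) j : j < count snd c ->
  exists A v T, c = A ++ (v, true) :: T /\ count snd T = j.
Proof.
elim: c => //= -[u b] c IH /= ltj.
case: (ltnP j (count snd c)) => [/IH[A [v [T [-> ET]]]]|lej].
  by exists ((u, b) :: A), v, T.
by case: b ltj => /= ltj; [exists [::], u, c; split=> //; lia | lia].
Qed.

Lemma split_at_true_inj (A A' T T' : seq (nat * bool)) v v' :
    A ++ (v, true) :: T = A' ++ (v', true) :: T' -> count snd T = count snd T' ->
  [/\ A = A', v = v' & T = T'].
Proof.
elim: A A' => [|a A IH] [|a' A'] //=.
- by move=> [-> ->].
- by move=> [_ ->]; rewrite count_cat /=; lia.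
- by move=> [_ <-]; rewrite count_cat /=; lia.
- by move=> [-> /IH{}IH] /IH[-> -> ->].
Qed.

(** * Local statistics of a word *)

Definition is_lrmin (m : nat) (w : seq nat) : bool := all (ltn m) (before m w).
(** The default [m.+1] plays the infinite letter in front of the word, and the
default 0 of the next definition the letter after its end. *)
Definition desc_in (m : nat) (w : seq nat) : bool :=
  m < last m.+1 (before m w).
Definition asc_out (m : nat) (w : seq nat) : bool := m < head 0 (after m w).

(** The occurrences of the vincular pattern 2-13 in which [m] plays the part
of 2. Including the pair that starts with [m] itself is harmless, since its
first component is not smaller than [m]. *)
Definition crossings (m : nat) (w : seq nat) : nat :=
  count (fun e => e.1 < m < e.2) (zip (m :: after m w) (after m w)).

(** Valley, peak, double ascent, double descent.  The start of a cycle has no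
arc on its left, so a double descent at a left-to-right minimum is a fixed
point and gives E. *)
Definition step_of_bits (b b' lr : bool) : step :=
  match b, b' with
  | true, true => StepN
  | false, false => StepS
  | false, true => StepE
  | true, false => if lr then StepE else StepF
  end.

(** E is the step of a double descent and of a double ascent; being a
left-to-right minimum tells them apart, because such a minimum follows a
larger letter. *)
Definition bits_of_step (a : step) (lr : bool) : bool * bool :=
  match a with
  | StepN => (true, true)
  | StepS => (false, false)
  | StepE => (lr, ~~ lr)
  | StepF => (true, false)
  end.

Definition word_step (m : nat) (w : seq nat) : step :=
  step_of_bits (desc_in m w) (asc_out m w) (is_lrmin m w).

Definition may_lead (a : step) : bool :=
  match a with StepN | StepE => true | StepS | StepF => false end.

Lemma may_lead_word_step m w :
  is_lrmin m w -> desc_in m w -> may_lead (word_step m w).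
Proof. by rewrite /word_step => -> ->; case: asc_out. Qed.

Lemma step_of_bitsK (b b' lr : bool) :
  (lr -> b) -> bits_of_step (step_of_bits b b' lr) lr = (b, b').
Proof. by case: b; case: b'; case: lr => // /(_ isT). Qed.

Lemma bits_of_stepK a (lr : bool) : (lr -> may_lead a) ->
  step_of_bits (bits_of_step a lr).1 (bits_of_step a lr).2 lr = a.
Proof. by case: a; case: lr => // /(_ isT). Qed.

(** The two bits are those of the inserted letter and of the block it is put
in front of, whose bit was set before: their sum minus one is the change in
the number of blocks. *)
Lemma step_vec_bits a (lr : bool) :
  (((bits_of_step a lr).1 + (bits_of_step a lr).2)%N%:Z - 1 = (step_vec a).2)%R.
Proof. by case: a; case: lr. Qed.

(** * Blocks of small letters *)

(** Here [p] is the letter preceding [w].  A letter is kept when it is at most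
[k], and its bit is set when the preceding letter is not kept, so that the set
bits mark the starts of the blocks of consecutive kept letters. *)
Fixpoint entries (k p : nat) (w : seq nat) : seq (nat * bool) :=
  if w is v :: w' then
    if v <= k then (v, k < p) :: entries k v w' else entries k v w'
  else [::].

(** In front, [n.+1] plays the infinite letter.  The final 0 is always kept,
so every letter is followed by a kept one. *)
Definition profile (n k : nat) (w : seq nat) := entries k n.+1 (rcons w 0).

Lemma entries_cat k p L R :
  entries k p (L ++ R) = entries k p L ++ entries k (last p L) R.
Proof. by elim: L p => //= v L IH p; case: ifP; rewrite IH. Qed.

(** Raising the bound by one only affects the new letter and the bit of its
successor. *)
Lemma entries_stable k p w :
  k.+1 \notin p :: w -> entries k.+1 p w = entries k p w.
Proof.
elim: w p => //= v w IH p; rewrite inE negb_or => /andP[kp kv].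
rewrite IH //; move: kv; rewrite inE negb_or => /andP[kv _].
have -> : (v <= k.+1) = (v <= k) by lia.
by have -> : (k.+1 < p) = (k < p) by lia.
Qed.

Lemma entries_head k p w : k < p -> 0 \in w ->
  exists v T, entries k p w = (v, true) :: T.
Proof.
elim: w p => //= v w IH p kp; rewrite inE.
case: (leqP v k) => [vk _|kv]; first by rewrite kp; exists v, (entries k v w).
by case/orP => [/eqP v0|/(IH _ kv)]; first by rewrite -v0 in kv.
Qed.

Lemma entries_le k p w : all (fun e => e.1 <= k) (entries k p w).
Proof. by elim: w p => //= v w IH p; case: ifP => //= ->; rewrite IH. Qed.

Lemma entries_nil k p w : (entries k p w == [::]) = all (ltn k) w.
Proof. by elim: w p => //= v w IH p; rewrite -(IH v); case: (leqP v k). Qed.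

(** Every block except the last ends with an ascent from a letter at most [k]
to a larger one, and conversely; a block is thus counted by the ascent that
precedes it, and the first one by [k < p]. *)
Lemma entries_count k p w :
  count snd (entries k p (rcons w 0)) =
  (k < p) + count (fun e => e.1 <= k < e.2) (zip (p :: w) w).
Proof.
elim: w p => [|v w IH] p /=; first by rewrite addn0.
by case: (leqP v k) => [vk|kv] /=; rewrite IH; case: (leqP p k); lia.
Qed.

(** What follows [k.+1]: at level [k] the next kept letter starts a block
because [k.+1], or another large letter, precedes it; at level [k.+1] it stops
doing so exactly when it is adjacent to [k.+1]. *)
Lemma entries_insert k R : k.+1 \notin R ->
  exists v T, entries k k.+1 (rcons R 0) = (v, true) :: T /\
    entries k.+1 k.+1 (rcons R 0) = (v, k.+1 < head 0 R) :: T.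
Proof.
case: R => [|v R] /=; first by exists 0, [::]; rewrite leqnn ltnn.
rewrite inE negb_or => /andP[kv kR]; rewrite ltnn leqnn.
have stab : entries k.+1 v (rcons R 0) = entries k v (rcons R 0).
  by apply: entries_stable; rewrite inE mem_rcons inE !negb_or kv kR.
case: (leqP v k) => [vk|vk].
  exists v, (entries k v (rcons R 0)); rewrite stab.
  by rewrite (leq_trans vk) // ltnNge (leq_trans vk).
have [] := @entries_head k v (rcons R 0) vk; first by rewrite mem_rcons mem_head.
move=> u [T ET]; exists u, T; rewrite stab ET.
have ltkv : k.+1 < v by rewrite ltn_neqAle kv vk.
by rewrite leqNgt ltkv.
Qed.

(** The insertion step.  The block which starts with [v] is the one in front
of which [k.+1] is put; the statistics of [k.+1] in the whole word can be read
off from the place of that block and from the two new bits. *)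
Lemma profile_step n w k : perm_eq w (iota 1 n) -> k < n ->
  exists A v T,
    [/\ profile n k w = A ++ (v, true) :: T,
        profile n k.+1 w =
          A ++ (k.+1, desc_in k.+1 w) :: (v, asc_out k.+1 w) :: T,
        (A == [::]) = is_lrmin k.+1 w,
        count snd T = crossings k.+1 w
      & is_lrmin k.+1 w -> desc_in k.+1 w].
Proof.
move=> Hw ltkn.
have kw : k.+1 \in w by rewrite (perm_mem Hw) mem_iota; lia.
have Uw : uniq w by rewrite (perm_uniq Hw) iota_uniq.
case/splitPr: kw Uw {Hw} => L R.
case/uniq_cat_cons=> kL kR.
have [v [T [E1 E2]]] := entries_insert k R kR.
rewrite /is_lrmin /asc_out /desc_in /crossings before_cat // after_cat //.
rewrite /profile rcons_cat !entries_cat /= leqnn ltnn E1 E2.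
exists (entries k n.+1 L), v, T; split=> //.
- rewrite entries_stable; last by rewrite inE negb_or kL andbT; lia.
  by case: (L) => //= ; rewrite !ltnS ltkn leqnn.
- rewrite entries_nil; apply: eq_in_all => u uL /=.
  by have : u != k.+1 by [apply: contraNneq kL => <-]; lia.
- have := entries_count k k.+1 R; rewrite E1 ltnSn => /addnI.
  rewrite -/(count snd T) => ->; apply: eq_in_count => e /(map_f snd).
  rewrite -/(unzip2 _) unzip2_zip // => eR.
  have : e.2 != k.+1 by apply: contraNneq kR => <-.
  by rewrite ltnS => ne; rewrite [k < e.2]leq_eqVlt eq_sym (negPf ne).
- by case/lastP: (L) => //= L' u; rewrite all_rcons last_rcons => /andP[].
Qed.

Lemma entries_fst k p w : map fst (entries k p w) = [seq v <- w | v <= k].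
Proof. by elim: w p => //= v w IH p; case: ifP => //= _; rewrite IH. Qed.

(** Nothing is dropped, so no block starts in [w]: all its letters continue
the one of [p]. *)
Lemma entries_below k p w : p <= k -> all (geq k) w ->
  entries k p w = [seq (v, false) | v <- w].
Proof.
by elim: w p => //= v w IH p lepk /andP[vk wk]; rewrite vk ltnNge lepk /= IH.
Qed.

Lemma profile_head n k w : k <= n -> exists v T, profile n k w = (v, true) :: T.
Proof. by move=> lekn; apply: entries_head; rewrite ?mem_rcons ?mem_head. Qed.

(** These conditions hold for the profiles of level [k] of the words with
letters 1, ..., n, for [k] at most n.  They do not mention a word, so that
they can be checked after an insertion before any word is known to have the
new profile. *)
Definition admissible (k : nat) (c : seq (nat * bool)) : Prop :=
  [/\ perm_eq (map fst c) (iota 0 k.+1), last 0 (map fst c) = 0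
    & head true (map snd c)].

Lemma profile_last n w : perm_eq w (iota 1 n) ->
  map fst (profile n n w) = rcons w 0.
Proof.
move=> Hw; rewrite entries_fst; apply/all_filterP; rewrite all_rcons /=.
by apply/allP => v; rewrite (perm_mem Hw) mem_iota; lia.
Qed.

(** A profile of level [n] with a single block is a word together with
redundant bits: only the first of them is set. *)
Lemma profile_last_exists n c : admissible n c -> count snd c = 1 ->
  exists2 w, perm_eq w (iota 1 n) & profile n n w = c.
Proof.
case=> Hc; case/lastP Ew: (map fst c) Hc => [|w z]; first by move/perm_size.
rewrite last_rcons => Hw z0; subst z => hc c1; exists w.
  by move: Hw; rewrite perm_rcons /= perm_cons.
have all_le : all (geq n) (map fst c).
  by apply/allP => v; rewrite Ew (perm_mem Hw) mem_iota.
rewrite /profile -Ew; case: c hc c1 all_le {Ew Hw} => [|[u b] c] //= ->.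
move=> c1 /andP[un cn]; rewrite un ltnS leqnn entries_below //.
congr (_ :: _); rewrite -map_comp -[RHS]map_id; apply/eq_in_map => -[v b'] vc /=.
congr pair; apply/esym/negbTE/negP => b't.
have : has snd c by apply/hasP; exists (v, b').
by rewrite has_count; lia.
Qed.

(** * Cycle form and word *)

Section CycleForm.

Variable n : nat.
Implicit Types (s t : 'S_n) (k m u v : 'I_n).

Definition word s : seq 'I_n := flatten (cycle_form s).

Definition cycle_mins s : seq 'I_n := [seq m <- rev (enum 'I_n) | cycle_min s m].

Lemma cycle_min_lt s m j :
  cycle_min s m -> j \in porbit s m -> j != m -> m < j.
Proof.
by move=> /forall_inP mP /mP mj ne; rewrite ltn_neqAle eq_sym mj andbT.
Qed.

Lemma cycle_min_inj s m m' :
  cycle_min s m -> cycle_min s m' -> m' \in porbit s m -> m' = m.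
Proof.
move=> mP m'P m'm; apply/eqP; apply: contraT => ne.
have := cycle_min_lt s m' m m'P.
rewrite porbit_sym m'm eq_sym => /(_ isT ne).
by have := cycle_min_lt s m m' mP m'm ne; lia.
Qed.

Lemma cycle_min_exists s k : exists2 m, cycle_min s m & k \in porbit s m.
Proof.
have [m mk mP] := @arg_minnP _ k (mem (porbit s k)) val (porbit_id s k).
exists m; last by rewrite porbit_sym.
have /eqP Emk : porbit s m == porbit s k by rewrite eq_porbit_mem.
by rewrite /cycle_min Emk; apply/forall_inP.
Qed.

Lemma mem_cycle_mins s m : (m \in cycle_mins s) = cycle_min s m.
Proof. by rewrite mem_filter mem_rev mem_enum andbT. Qed.

Lemma cycle_mins_decreasing s : pairwise (fun i j : 'I_n => j < i) (cycle_mins s).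
Proof.
apply: pairwise_filter; rewrite -sorted_pairwise; last first.
  by move=> j i k ltji ltkj; apply: ltn_trans ltkj ltji.
rewrite rev_sorted; have := iota_ltn_sorted 0 n.
by rewrite -val_enum_ord sorted_map.
Qed.

Lemma mem_traject_porbit s m j :
  (j \in traject s m #|porbit s m|) = (j \in porbit s m).
Proof. by rewrite porbit_traject. Qed.

Lemma cycle_traject s m : exists2 c,
  traject s m #|porbit s m| = m :: c & m \notin c.
Proof.
have := uniq_traject_porbit s m.
case: #|_| (porbit_id s m) (mem_traject_porbit s m m) => [|N] /=.
  by move=> ->.
by move=> _ _ /andP[mc _]; exists (traject s (s m) N).
Qed.

Lemma mem_word s k : k \in word s.
Proof.
have [m mP km] := cycle_min_exists s k.
apply/flatten_mapP; exists m; first by rewrite -/(cycle_mins s) mem_cycle_mins.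
by rewrite mem_traject_porbit.
Qed.

Lemma uniq_word s : uniq (word s).
Proof.
rewrite /word /cycle_form -/(cycle_mins s).
have : all (cycle_min s) (cycle_mins s) by apply: filter_all.
have : uniq (cycle_mins s) by rewrite filter_uniq // rev_uniq enum_uniq.
elim: (cycle_mins s) => //= m ms IH /andP[mms Ums] /andP[mP msP].
rewrite cat_uniq uniq_traject_porbit {}IH // andbT -all_predC.
apply/allP => j /flatten_mapP[m' m'ms]; rewrite mem_traject_porbit => jm' /=.
rewrite mem_traject_porbit; apply: contra mms => jm.
rewrite (cycle_min_inj s m' m _ mP) ?(allP msP) //.
by move: jm jm'; rewrite -!eq_porbit_mem => /eqP-> /eqP->.
Qed.

(** The letters before the start of a cycle belong to earlier cycles, whose
minima are larger; any other letter comes after the minimum of its own cycle.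
*)
Lemma cycle_min_word s k L R :
  word s = L ++ k :: R -> cycle_min s k = all (fun i : 'I_n => k < i) L.
Proof.
move=> Ew; have [m mP km] := cycle_min_exists s k.
have mms : m \in cycle_mins s by rewrite mem_cycle_mins.
have kc : k \in traject s m #|porbit s m| by rewrite mem_traject_porbit.
pose cycles ms := flatten [seq traject s i #|porbit s i| | i <- ms].
have [M1 [M2 EM]] : exists M1 M2, cycle_mins s = M1 ++ m :: M2.
  by case/splitPr: mms => M1 M2; exists M1, M2.
have [C1 [C2 EC]] : exists C1 C2, traject s m #|porbit s m| = C1 ++ k :: C2.
  by case/splitPr: kc => C1 C2; exists C1, C2.
have Ew' : word s = (cycles M1 ++ C1) ++ k :: (C2 ++ cycles M2).
  rewrite /word /cycle_form -/(cycle_mins s) EM map_cat flatten_cat /= EC.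
  by rewrite -!catA.
have [kL _] : k \notin L /\ k \notin R.
  by apply: uniq_cat_cons; rewrite -Ew uniq_word.
have [kF _] : k \notin cycles M1 ++ C1 /\ k \notin C2 ++ cycles M2.
  by apply: uniq_cat_cons; rewrite -Ew' uniq_word.
have := congr1 (before k) Ew; rewrite Ew' !before_cat //.
move=> <- {L R Ew kL}; rewrite all_cat.
have ltF1 i : i \in cycles M1 -> m < i.
  case/flatten_mapP=> m' m'M; rewrite mem_traject_porbit => im'.
  have := cycle_mins_decreasing s.
  rewrite EM pairwise_cat => /andP[/allrelP /(_ m' m m'M)].
  rewrite mem_head => /(_ isT) ltmm' _; apply: leq_trans ltmm' _.
  have : m' \in cycle_mins s by rewrite EM mem_cat m'M.
  by rewrite mem_cycle_mins => /forall_inP; apply.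
have [c Ec mc] := cycle_traject s m.
(* Either k is the minimum m of its cycle, or m itself precedes k. *)
case: C1 EC kF {Ew'} => [|m1 C1]; rewrite Ec => -[E1 E2] kF.
  rewrite -E1 mP /= andbT; apply/esym/allP => i; exact: ltF1.
rewrite /= -E1.
have kNm : k != m by apply: contraNneq mc => <-; rewrite E2 mem_cat mem_head orbT.
have ltmk := cycle_min_lt s m k mP km kNm.
rewrite [k < m]ltnNge (ltnW ltmk) /= andbF.
by apply: contraNF kNm => kP; rewrite (cycle_min_inj s m k).
Qed.

Lemma arcs_traject s :
  arcs s = flatten
    [seq [seq (i, s i) | i <- traject s m #|porbit s m|.-1] | m <- cycle_mins s].
Proof.
rewrite /arcs /cycle_form -/(cycle_mins s) -map_comp; congr flatten.
by apply: eq_map => m /=; rewrite zip_traject.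
Qed.

(** The only adjacent pairs of the word that are not arcs are those joining
the end of a cycle to the start of the next one. *)
Lemma arcs_word s :
  arcs s = [seq e <- zip (word s) (behead (word s)) | ~~ cycle_min s e.2].
Proof.
apply: filter_zip_flatten; apply/allP => _ /mapP[m + ->].
rewrite -/(cycle_mins s) mem_cycle_mins => mP.
have [c Ec mc] := cycle_traject s m; rewrite Ec mP /=.
apply/allP => i ic; apply: contra mc => /= iP.
by rewrite -(cycle_min_inj s m i) // -mem_traject_porbit Ec inE ic orbT.
Qed.

(** The closing step of each cycle, which is not drawn, is the one leading to
its minimum. *)
Lemma mem_arcs s u v :
  ((u, v) \in arcs s) = (v == s u) && ~~ cycle_min s v.
Proof.
apply/idP/andP=> [uv|[/eqP-> suP]].
  have : (u, v) \in arcs s by [].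
  rewrite {1}arcs_word mem_filter => /andP[-> _]; split=> //.
  move: uv; rewrite arcs_traject => /flatten_mapP[m _ /mapP[i _ [-> ->]]].
  exact: eqxx.
have [m mP um] := cycle_min_exists s u.
rewrite arcs_traject; apply/flatten_mapP; exists m.
  by rewrite mem_cycle_mins.
apply/map_f; move: um; rewrite -mem_traject_porbit => /trajectP[i lti Eu].
apply/trajectP; exists i => //; rewrite -ltnS prednK ?lt0n ?card_porbit_neq0 //.
rewrite ltn_neqAle lti andbT; apply: contra suP => /eqP Ei.
by rewrite Eu -iterS Ei iter_porbit.
Qed.

(** The word determines the left-to-right minima, hence the minima of the
cycles and the arcs.  Walking along a cycle from its minimum, the arcs
determine the next node, unless the cycle closes up, and then the next node is
the minimum again. *)
Lemma word_inj : injective word.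
Proof.
move=> s t Est.
have Emin k : cycle_min s k = cycle_min t k.
  have := mem_word s k; case/splitPr Ew: {1}(word s) / => [L R].
  by rewrite (cycle_min_word s k L R Ew) (cycle_min_word t k L R) -?Est.
have Earcs : arcs s = arcs t.
  by rewrite !arcs_word Est; apply: eq_filter => e; rewrite Emin.
have Eiter m i : cycle_min s m -> iter i s m = iter i t m.
  move=> mP; elim: i => //= i IH.
  have closes (r : 'S_n) : cycle_min r m -> cycle_min r (r (iter i r m)) ->
      r (iter i r m) = m.
    move=> mrP rP; apply: (cycle_min_inj r) => //.
    by rewrite -iterS -permX mem_porbit.
  case suP: (cycle_min s (s (iter i s m))).
    rewrite closes //; case tuP: (cycle_min t (t (iter i t m))).
      by rewrite closes // -Emin.
    have : (iter i t m, t (iter i t m)) \in arcs t by rewrite mem_arcs eqxx tuP.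
    rewrite -Earcs mem_arcs -IH Emin => /andP[/eqP -> _].
    by rewrite closes.
  have : (iter i s m, s (iter i s m)) \in arcs s by rewrite mem_arcs eqxx suP.
  by rewrite Earcs mem_arcs IH => /andP[/eqP].
apply/permP => u; have [m mP] := cycle_min_exists s u.
rewrite -mem_traject_porbit => /trajectP[i _ ->].
by rewrite -iterS Eiter // iterS -Eiter.
Qed.

Definition nword s : seq nat := [seq (i : nat).+1 | i : 'I_n <- word s].

Lemma nword_inj : injective nword.
Proof. by move=> s t /inj_map E; apply/word_inj/E => i j [/val_inj]. Qed.

Lemma nword_perm s : perm_eq (nword s) (iota 1 n).
Proof.
rewrite (iotaDl 1 0) -val_enum_ord -map_comp; apply: perm_map.
apply: uniq_perm; rewrite ?uniq_word ?enum_uniq // => i.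
by rewrite mem_word mem_enum.
Qed.

(** An injective map from the n! permutations to the n! words is onto. *)
Lemma nword_surj (w : seq nat) : perm_eq w (iota 1 n) -> exists s, nword s = w.
Proof.
move=> Hw; pose W := [seq nword s | s <- enum 'S_n].
have [_ EW] : (size W = size (permutations (iota 1 n))) *
              (W =i permutations (iota 1 n)).
  apply: uniq_min_size.
  - by rewrite map_inj_uniq ?enum_uniq //; apply: nword_inj.
  - by move=> _ /mapP[s _ ->]; rewrite mem_permutations nword_perm.
  - by rewrite size_permutations ?iota_uniq // size_iota size_map -cardE card_Sn.
have : w \in W by rewrite EW mem_permutations.
by case/mapP=> s _ ->; exists s.
Qed.

Lemma word_split s k : exists L R,
  [/\ word s = L ++ k :: R, k \notin L & k \notin R].
Proof.
have := uniq_word s; case/splitPr: (mem_word s k) => L R /uniq_cat_cons[kL kR].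
by exists L, R.
Qed.

Lemma nword_split s k L R : word s = L ++ k :: R -> k \notin L ->
  before k.+1 (nword s) = [seq (i : nat).+1 | i : 'I_n <- L] /\
  after k.+1 (nword s) = [seq (i : nat).+1 | i : 'I_n <- R].
Proof.
move=> Ew kL; rewrite /nword Ew map_cat /=.
have kL' : k.+1 \notin [seq (i : nat).+1 | i : 'I_n <- L].
  by rewrite (mem_map (f := fun i : 'I_n => i.+1)) // => i j [/val_inj].
by rewrite before_cat ?after_cat.
Qed.

Lemma nword_lrmin s k : is_lrmin k.+1 (nword s) = cycle_min s k.
Proof.
have [L [R [Ew kL kR]]] := word_split s k.
rewrite /is_lrmin (nword_split s k L R Ew kL).1 all_map.
by rewrite (cycle_min_word s k L R Ew).
Qed.

Lemma count_split (T : Type) (P Q : pred T) w :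
  count (fun e => P e && ~~ Q e) w + count (fun e => P e && Q e) w = count P w.
Proof. by elim: w => //= e w <-; case: (P e); case: (Q e) => /=; lia. Qed.

(** An arc starting before [k] in the word is drawn before [k] is visited, and
an ascent after [k] that passes over [k] ends above [k], hence not at the
start of a cycle: it is an arc. *)
Lemma nword_crossings s k :
  arcs_over_diff s k + arcs_over_same s k = crossings k.+1 (nword s).
Proof.
have [L [R [Ew kL kR]]] := word_split s k.
rewrite /arcs_over_diff /arcs_over_same count_split arcs_word count_filter.
rewrite Ew zip_behead_split count_cat /crossings (nword_split s k L R Ew kL).2.
have Eindex : index k (L ++ k :: R) = size L.
  by rewrite index_cat (negPf kL) /= eqxx addn0.
rewrite -[RHS]add0n; congr (_ + _).
  apply/eqP; rewrite -leqn0 leqNgt -has_count; apply/hasPn => e /mem_zip[e1L _].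
  rewrite /passes_after /= -/(word s) Ew Eindex index_cat e1L.
  by rewrite [size L <= _]leqNgt index_mem e1L !andbF.
rewrite -[_ :: map _ _]/(map (fun i : 'I_n => i.+1) (k :: R)).
rewrite zip_map_both count_map.
apply: eq_in_count => -[u v] /mem_zip[/= ukR vR].
rewrite /passes_after /= -/(word s) Ew Eindex /= !ltnS.
have -> : size L <= index u (L ++ k :: R).
  rewrite index_cat ifN ?leq_addr //.
  have := uniq_word s; rewrite Ew cat_uniq => /and3P[_ /hasPn /(_ u ukR)].
  by [].
rewrite andbT; case: ltnP => //= uk; case: (ltnP k v) => //= kv.
case/splitPr: vR Ew {Eindex ukR kR} => R1 R2; rewrite -cat_cons catA => Ew.
by rewrite (cycle_min_word s v _ _ Ew) all_cat /= ltnNge (ltnW kv) /= andbF.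
Qed.

(** The arrows on the two sides of [k] come from the arc entering [k] and the
arc leaving it.  That an arc leaves [k] to the left need not be decided: it
happens only at a descent and only when [k] does not start its cycle, and then
the step is the same with or without it. *)
Lemma nword_step s k : tnth (mapM s) k = word_step k.+1 (nword s).
Proof.
have [L [R [Ew kL kR]]] := word_split s k.
have [EL ER] := nword_split s k L R Ew kL.
have in_arc u : ((u, k) \in arcs s) =
    ~~ cycle_min s k && (if L is x :: L' then u == last x L' else false).
  rewrite arcs_word mem_filter; congr (_ && _).
  rewrite Ew zip_behead_split mem_cat orbC.
  have -> : (u, k) \in zip (k :: R) R = false.
    by apply/negP => /mem_zip[_ /=]; rewrite (negPf kR).
  case: (L) kL => //= x L'; rewrite inE negb_or => /andP[_ kL'].
  rewrite zip_behead_rcons mem_rcons inE xpair_eqE eqxx andbT.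
  case: eqP => //= _; apply/negP => /mem_zip[_ /=]; rewrite (negPf kL') //.
have out_arc v : ((k, v) \in arcs s) =
    ~~ cycle_min s v && (if R is y :: _ then v == y else false).
  rewrite arcs_word mem_filter; congr (_ && _).
  rewrite Ew zip_behead_split mem_cat.
  have -> : (k, v) \in zip L (rcons (behead L) k) = false.
    by apply/negP => /mem_zip[/= kL'' _]; rewrite kL'' in kL.
  case: (R) kR => //= y R'; rewrite inE negb_or => /andP[ky kR'].
  rewrite inE xpair_eqE eqxx /=.
  case: eqP => //= _; apply/negP => /mem_zip[/= ]; rewrite inE.
  by rewrite (negPf ky) (negPf kR').
have minE := cycle_min_word s k L R Ew.
have left_in : [exists u : 'I_n, (u < k) && ((u, k) \in arcs s)] =
          ~~ desc_in k.+1 (nword s).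
  rewrite /desc_in EL; case: (L) kL in_arc minE => [|x L'] kL in_arc minE.
    by rewrite /= leqnn; apply/existsP => -[u]; rewrite in_arc !andbF.
  rewrite [last _ _]/= (last_map (fun i : 'I_n => i.+1)) ltnS.
  have ne : last x L' != k by apply: contraNneq kL => <-; rewrite mem_last.
  apply/existsP/idP => [[u /andP[uk]]|].
    by rewrite in_arc => /andP[_ /eqP <-]; rewrite -leqNgt ltnW.
  rewrite -leqNgt leq_eqVlt (inj_eq val_inj) (negPf ne) /= => lk.
  exists (last x L'); rewrite lk in_arc eqxx andbT minE.
  by apply/negP => /allP /(_ _ (mem_last _ _)); rewrite ltnNge ltnW.
have right_in : [exists v : 'I_n, (k < v) && ((v, k) \in arcs s)] =
          ~~ cycle_min s k && desc_in k.+1 (nword s).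
  rewrite /desc_in EL; case: (L) kL in_arc minE => [|x L'] kL in_arc minE.
    by rewrite minE /=; apply/existsP => -[u]; rewrite in_arc !andbF.
  rewrite [last _ _]/= (last_map (fun i : 'I_n => i.+1)) ltnS.
  apply/existsP/andP => [[v /andP[kv]]|[kP kv]].
    by rewrite in_arc => /andP[-> /eqP <-].
  by exists (last x L'); rewrite in_arc eqxx kP kv.
have right_out : [exists v : 'I_n, (k < v) && ((k, v) \in arcs s)] =
          asc_out k.+1 (nword s).
  rewrite /asc_out ER; case: (R) Ew out_arc => [|y R'] Ew out_arc /=.
    by apply/existsP => -[u]; rewrite out_arc !andbF.
  rewrite ltnS; apply/existsP/idP => [[v /andP[kv]]|ky].
    by rewrite out_arc => /andP[_ /eqP <-].
  exists y; rewrite ky out_arc eqxx andbT -cat_rcons in Ew *.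
  by rewrite (cycle_min_word s y _ _ Ew) all_rcons ltnNge ltnW.
have left_out : [exists u : 'I_n, (u < k) && ((k, u) \in arcs s)] ->
          ~~ asc_out k.+1 (nword s) && ~~ cycle_min s k.
  case/existsP=> u /andP[uk ku]; apply/andP; split.
    move: ku; rewrite out_arc /asc_out ER.
    by case: (R) => [|y R'] /andP[_] // /eqP <- /=; rewrite ltnS -leqNgt ltnW.
  move: ku; rewrite mem_arcs => /andP[/eqP Eu _]; apply/negP => /forall_inP.
  by move=> /(_ u); rewrite leqNgt uk Eu (mem_porbit s 1) => /(_ isT).
rewrite tnth_mktuple /word_step nword_lrmin /left_shape /right_shape.
rewrite left_in right_out right_in; move: left_out; case: [exists _, _].
  by move=> /(_ isT) /andP[/negPf-> /negPf->]; case: (desc_in _ _).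
move=> _; have : cycle_min s k -> desc_in k.+1 (nword s).
  rewrite /desc_in EL minE; case/lastP: (L) => //= L' x.
  by rewrite all_rcons map_rcons last_rcons => /andP[].
case: (cycle_min s k) => [/(_ isT)->|_] /=; first by case: (asc_out _ _).
by case: (desc_in _ _); case: (asc_out _ _).
Qed.

End CycleForm.

Arguments nword {n}.

(** * Motzkin paths *)

Lemma vertexS (p : seq step) k : k < size p ->
  (vertex p k.+1 = vertex p k + step_vec (nth StepN p k))%R.
Proof. by move=> ltk; rewrite /vertex (take_nth StepN) // big_rcons /= addrC. Qed.

Lemma vertex1 (p : seq step) k : k <= size p -> ((vertex p k).1 = k%:Z)%R.
Proof.
elim: k => [|k IH] ltk; first by rewrite /vertex take0 big_nil.
rewrite vertexS //= IH ?(ltnW ltk) //.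
by case: (nth _ _ _) => /=; lia.
Qed.

Section Motzkin.

Variable n : nat.
Implicit Types (s : 'S_n) (p : n.-tuple step).

Lemma nth_tnth p k (lt_kn : k < n) : nth StepN p k = tnth p (Ordinal lt_kn).
Proof. by rewrite (tnth_nth StepN). Qed.

(** The height is the number of blocks not counting the last one. *)
Lemma vertex2_mapM s k : k <= n ->
  ((vertex (mapM s) k).2 = (count snd (profile n k (nword s)))%:Z - 1)%R.
Proof.
have Hw := nword_perm n s.
elim: k => [|k IH] lekn.
  rewrite /vertex take0 big_nil /= /profile entries_count /=.
  rewrite (eq_in_count (a2 := pred0)) ?count_pred0 // => e /mem_zip[+ _].
  by rewrite inE (perm_mem Hw) mem_iota /=; lia.
rewrite vertexS ?size_tuple // (nth_tnth _ _ lekn) /= IH ?(ltnW lekn) //.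
have [A [v [T [-> -> lrE _ lr_b]]]] := profile_step n _ k Hw lekn.
rewrite nword_step -(step_vec_bits _ (is_lrmin k.+1 (nword s))) step_of_bitsK //.
by rewrite !count_cat /=; lia.
Qed.

Lemma mapM_motzkin s : mapM s \in motzkin_paths n.
Proof.
have Hw := nword_perm n s.
have count_gt0 k : k <= n -> 0 < count snd (profile n k (nword s)).
  by move=> lekn; have [v [T ->]] := profile_head n k (nword s) lekn.
rewrite inE; apply/andP; split.
  apply/andP; split.
    apply/forallP => k; have lekn : k <= n by rewrite -ltnS.
    rewrite vertex1 ?size_tuple // vertex2_mapM //.
    by have := count_gt0 k lekn; lia.
  have <- : (vertex (mapM s) n).1 = Posz n by rewrite vertex1 ?size_tuple.
  rewrite [X in X == _]surjective_pairing xpair_eqE eqxx vertex2_mapM //=.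
  rewrite /profile entries_count ltnSn (eq_in_count (a2 := pred0)).
    by rewrite count_pred0.
  by move=> e /mem_zip[_]; rewrite (perm_mem Hw) mem_iota /=; lia.
apply/forallP => k; apply/implyP; rewrite nword_step /height => /eqP kF.
rewrite vertex2_mapM ?(ltnW (ltn_ord k)) //.
have [A [v [T [EA _ lrE _ lr_b]]]] := profile_step n _ k Hw (ltn_ord k).
have A0 : A == [::] = false.
  rewrite lrE; apply/negP => lr; have := may_lead_word_step _ _ lr (lr_b lr).
  by rewrite kF.
have [u [U EU]] := profile_head n k (nword s) (ltnW (ltn_ord k)).
move: EU; rewrite EA; case: A A0 {lrE EA} => //= a A _ [-> _].
by rewrite /= count_cat /=; lia.
Qed.

(** * Summation over a class *)

Section Sum.

Variables (R : comNzRingType) (x q : R).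
Local Open Scope ring_scope.

Lemma node_weight_word s (k : 'I_n) :
  node_weight x q s k =
  x ^+ is_lrmin k.+1 (nword s) * q ^+ crossings k.+1 (nword s).
Proof. by rewrite /node_weight nword_crossings nword_lrmin. Qed.

(** The index [j] is the number of blocks following the one chosen for the
insertion; [j == h] means the first block, whose choice creates a
left-to-right minimum and is open to N and E only. *)
Lemma step_weight_sum a h :
  step_weight x q a h =
  \sum_(j < h.+1) (if (j == h :> nat) ==> may_lead a
                   then x ^+ (j == h :> nat) * q ^+ j else 0).
Proof.
rewrite big_ord_recr /= eqxx.
have -> : \sum_(i < h) (if (i == h :> nat) ==> may_lead a
    then x ^+ (i == h :> nat) * q ^+ i else 0) = qint q h.
  by apply: eq_bigr => i _; rewrite (ltn_eqF (ltn_ord i)) /= mul1r.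
by case: a => /=; rewrite ?addr0 ?expr1.
Qed.

(** The permutations that can still be reached when the letters up to [k] have
formed the blocks [c] and the remaining steps are those of [p]. *)
Definition continues p k c : pred 'S_n := fun s =>
  (profile n k (nword s) == c) &&
  [forall i : 'I_n, (k <= i)%N ==> (tnth (mapM s) i == tnth p i)].

Lemma big_ge_recl (F : 'I_n -> R) k (lt_kn : (k < n)%N) :
  \prod_(i : 'I_n | (k <= i)%N) F i =
  F (Ordinal lt_kn) * \prod_(i : 'I_n | (k < i)%N) F i.
Proof.
rewrite (bigD1 (Ordinal lt_kn)) //=; congr (_ * _); apply: eq_bigl => i.
by rewrite -(inj_eq val_inj) /= ltn_neqAle eq_sym andbC.
Qed.

Lemma forall_ge_recl (P : pred 'I_n) k (lt_kn : (k < n)%N) :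
  [forall i : 'I_n, (k <= i)%N ==> P i] =
  P (Ordinal lt_kn) && [forall i : 'I_n, (k < i)%N ==> P i].
Proof.
apply/forall_inP/andP => [Pk|[Pk /forall_inP P_gt] i].
  by split; [apply: Pk | apply/forall_inP => i /ltnW /Pk].
rewrite leq_eqVlt => /orP[/eqP ki|/P_gt//].
by have -> : i = Ordinal lt_kn by apply/val_inj.
Qed.

(** Once the type of the next step is prescribed, the number of blocks after
the chosen one determines the insertion, and the insertion can be undone
because [k.+1] occurs only once. *)
Lemma continues_step p k (lt_kn : (k < n)%N) A v T (lr := A == [::]) :
    let c := A ++ (v, true) :: T in
    let a := tnth p (Ordinal lt_kn) in
    let b := bits_of_step a lr in
    let c' := A ++ (k.+1, b.1) :: (v, b.2) :: T in
    admissible k c -> (lr -> may_lead a) ->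
  admissible k.+1 c' /\
  forall s, continues p k c s && (crossings k.+1 (nword s) == count snd T) =
            continues p k.+1 c' s.
Proof.
move=> c a b c' [cP cl ch] lr_a.
have kA : k.+1 \notin map fst A.
  apply/negP => kA; have : k.+1 \in map fst c by rewrite map_cat mem_cat kA.
  by rewrite (perm_mem cP) mem_iota; lia.
split.
  split.
  - have iotaP : perm_eq (k.+1 :: iota 0 k.+1) (iota 0 k.+2).
      by rewrite -[k.+2]addn1 iotaD perm_sym perm_catC.
    apply: perm_trans iotaP; rewrite /c' map_cat (perm_catCA _ [:: k.+1]).
    by rewrite perm_cons; move: cP; rewrite /c map_cat.
  - by move: cl; rewrite !map_cat !last_cat.
  - move: ch lr_a; rewrite /c /c' /b /lr; case: (A) => //= _ /(_ isT).
    by rewrite -/a; case: (a).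
move=> s; have Hw := nword_perm n s; rewrite /continues (forall_ge_recl _ _ lt_kn).
have [A1 [v1 [T1 [E1 E1' lrE cE lr_b]]]] := profile_step n _ k Hw lt_kn.
rewrite -/a nword_step /= -cE.
have kA1 : k.+1 \notin map fst A1.
  apply/negP => /mapP[e eA ke].
  have := entries_le k n.+1 (rcons (nword s) 0); rewrite -/(profile _ _ _) E1.
  by move=> /allP /(_ e); rewrite mem_cat eA -ke ltnn => /(_ isT).
apply/idP/idP => [/andP[/and3P[/eqP Ec /eqP aE ->] /eqP cT]|/andP[/eqP Ec' ->]].
  rewrite andbT E1'; move: Ec; rewrite E1 => Ec.
  have [EA Ev ET] := split_at_true_inj _ _ _ _ _ _ Ec cT.
  by rewrite /c' /b -aE /lr -EA lrE step_of_bitsK // EA Ev ET.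
rewrite andbT; move: Ec'; rewrite E1' /c' => Ec'.
have [EA [Eb] [Ev Eb' ET]] :=
  split_key _ _ fst _ _ _ _ _ _ Ec' erefl kA1 kA.
rewrite E1 EA Ev ET !eqxx andbT /=.
by rewrite /word_step -lrE EA Eb Eb' bits_of_stepK.
Qed.

(** Downward induction on [k], here as induction on [d], the number of letters
still to be inserted.  The permutations are sorted according to the block in
front of which [k.+1] is put. *)
Lemma sum_continues p d k c : (vertex p n).2 = 0 -> (k + d)%N = n ->
    admissible k c -> (vertex p k).2 = (count snd c)%:Z - 1 ->
  \sum_(s | continues p k c s) \prod_(i < n | (k <= i)%N) node_weight x q s i =
  \prod_(i < n | (k <= i)%N) step_weight x q (tnth p i) (height p i).
Proof.
move=> pn; elim: d k c => [|d IH] k c kd adm vk.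
  have kn : k = n by rewrite -kd addn0.
  subst k; have c1 : count snd c = 1%N by move: vk; rewrite pn; lia.
  have [w Hw Ec] := profile_last_exists n c adm c1.
  have [s Es] := nword_surj n w Hw.
  rewrite (big_pred1 s) => [|t]; last first.
    rewrite /continues /=; have -> : [forall i : 'I_n, (n <= i)%N ==>
        (tnth (mapM t) i == tnth p i)].
      by apply/forallP => i; rewrite leqNgt ltn_ord.
    rewrite andbT -(inj_eq (nword_inj n)) Es -Ec; apply/eqP/eqP => [Et|-> //].
    have := profile_last n _ (nword_perm n t); rewrite Et profile_last //.
    by move=> /rcons_inj[].
  by rewrite !big_pred0 // => i; rewrite leqNgt ltn_ord.
have lt_kn : (k < n)%N by rewrite -kd; lia.
have [_ _ ch] := adm.
have [h ch1] : exists h, count snd c = h.+1.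
  have [cP _ _] := adm.
  case: (c) cP ch => [/perm_size //|[u b] c0] _ /= ->.
  by exists (count snd c0).
have hk : height p k = h by rewrite /height vk ch1; lia.
rewrite (partition_big
  (fun s => inord (crossings k.+1 (nword s)) : 'I_h.+1) xpredT) //=.
rewrite big_ge_recl /= hk step_weight_sum big_distrl /=; apply: eq_bigr => j _.
have crossE s : profile n k (nword s) = c -> exists A v T,
    [/\ c = A ++ (v, true) :: T, count snd T = crossings k.+1 (nword s),
        (A == [::]) = (crossings k.+1 (nword s) == h),
        (A == [::]) = is_lrmin k.+1 (nword s)
      & is_lrmin k.+1 (nword s) -> may_lead (tnth (mapM s) (Ordinal lt_kn))].
  move=> Es.
  have [A [v [T [E1 _ lrE cE lr_b]]]] := profile_step n _ k (nword_perm n s) lt_kn.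
  exists A, v, T; rewrite -Es E1; split=> //.
    by rewrite (nil_count_true A T v) -E1 Es // ch1 cE eqSS eq_sym.
  move=> lr; rewrite nword_step; exact: may_lead_word_step lr (lr_b lr).
have crossj s : profile n k (nword s) = c ->
    ((inord (crossings k.+1 (nword s)) : 'I_h.+1) == j) =
    (crossings k.+1 (nword s) == j).
  move=> Es; have [A [v [T [Ec cE _ _ _]]]] := crossE s Es.
  rewrite -(inj_eq val_inj) /= inordK //.
  by rewrite -ch1 -cE Ec count_cat /=; lia.
(* No permutation puts the letter of an S or F step in front of the first block:
   that letter would be a left-to-right minimum. *)
case: ifPn => [jh_a|]; last first.
  rewrite negb_imply => /andP[/eqP jh a_no]; rewrite mul0r big1 // => s.
  case/andP=> /andP[/eqP Es /forall_inP sp]; rewrite crossj // => /eqP sj.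
  have [A [v [T [_ _ Ah lrE lr_a]]]] := crossE s Es.
  move: lr_a; rewrite -lrE Ah sj jh eqxx (eqP (sp (Ordinal lt_kn) _)) //.
  by move=> /(_ isT) a_yes; rewrite a_yes in a_no.
have [A [v [T [Ec cT]]]] : exists A v T,
    c = A ++ (v, true) :: T /\ count snd T = j.
  by apply: split_at_true; rewrite ch1.
have Aj : (A == [::]) = (j == h :> nat).
  by rewrite (nil_count_true A T v) -Ec // ch1 cT eqSS eq_sym.
have jhA : (A == [::]) -> may_lead (tnth p (Ordinal lt_kn)).
  by rewrite Aj; apply/implyP.
rewrite Ec in adm; have [adm' Es] := continues_step _ _ lt_kn _ _ _ adm jhA.
rewrite -(IH _ _ _ adm'); first last.
- rewrite vertexS ?size_tuple // (nth_tnth _ _ lt_kn) /= vk Ec.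
  by rewrite -(step_vec_bits _ (A == [::])) !count_cat /=; lia.
- by rewrite addSn -addnS.
rewrite big_distrr /=; apply: eq_big => [s|s /andP[/andP[/eqP Eprof _]]].
  rewrite -Es -Ec cT; case Eprof : (profile n k (nword s) == c).
    by rewrite crossj // (eqP Eprof).
  by rewrite /continues Eprof.
rewrite crossj // => /eqP sj; rewrite big_ge_recl node_weight_word /=.
have [A' [v' [T' [_ _ Ah lrE _]]]] := crossE s Eprof.
by rewrite -lrE Ah sj.
Qed.

Lemma sum_class p : (vertex p n).2 = 0 ->
  \sum_(s | mapM s == p) perm_weight x q s = path_weight x q p.
Proof.
move=> pn; have := sum_continues p n 0 [:: (0, true)] pn (add0n _).
rewrite /perm_weight /path_weight => <- //; last first.
  by rewrite /vertex take0 big_nil.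
apply: eq_bigl => s; rewrite /continues.
have [v [T ET]] := profile_head n 0 (nword s) (leq0n n).
have HF : map fst (profile n 0 (nword s)) = [:: 0%N].
  rewrite entries_fst filter_rcons /=.
  rewrite (eq_in_filter (a2 := pred0)) ?filter_pred0 // => u.
  by rewrite (perm_mem (nword_perm n s)) mem_iota; case: u.
have -> : profile n 0 (nword s) == [:: (0%N, true)].
  by move: HF; rewrite ET => -[->]; case: (T).
apply/eqP/forallP => [-> i|sp]; first by rewrite eqxx implybT.
by apply/eq_from_tnth => i; apply/eqP; have := sp i.
Qed.

End Sum.
End Motzkin.

(** * The bijection *)

Local Open Scope ring_scope.

(** At x = q = 1 a step starting at height [h] has weight [h] or [h.+1], and
[h] is nonzero for S because the path stays at nonnegative height, for F by
hypothesis. *)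
Lemma mapM_onto n (p : n.-tuple step) : p \in motzkin_paths n ->
  exists s, mapM s = p.
Proof.
rewrite inE => /andP[/andP[/forallP p_ge0 /eqP pn] /forallP noF].
have : \sum_(s | mapM s == p) perm_weight 1 1 s != 0 :> int.
  rewrite sum_class ?pn // /path_weight; apply/prodf_neq0 => k _.
  have qintE h : qint 1 h = h%:Z.
    rewrite /qint (eq_bigr (fun=> 1)) => [|i _]; last by rewrite expr1n.
    by rewrite sumr_const card_ord -natz.
  have weightE a h : step_weight 1 1 a h = (may_lead a + h)%N%:Z.
    by case: a; rewrite /= ?qintE // -/(qint _ _) qintE expr1n mulr1 addrC.
  rewrite weightE; have := noF k; have := p_ge0 (lift ord0 k).
  have := p_ge0 (widen_ord (leqnSn n) k).
  rewrite /= /bump leq0n add1n /height vertexS ?size_tuple //.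
  rewrite (nth_tnth _ _ _ (ltn_ord k)) (_ : Ordinal _ = k); last exact: val_inj.
  by case: (tnth p k) => /=; lia.
case: (pickP (fun s : 'S_n => mapM s == p)) => [s /eqP|none]; first by exists s.
by rewrite big_pred0 ?eqxx.
Qed.

Lemma Mclasses_mapM n (s : 'S_n) : Mclass (mapM s) \in Mclasses n.
Proof.
apply/imsetP; exists s => //; apply/setP => t.
by rewrite !inE /Mequiv eq_sym.
Qed.

Lemma MclassesP n (C : {set 'S_n}) :
  C \in Mclasses n -> exists s, C = Mclass (mapM s).
Proof.
case/imsetP=> s _ ->; exists s; apply/setP => t.
by rewrite !inE /Mequiv eq_sym.
Qed.

Lemma mapB_Mclass n (s : 'S_n) : mapB (Mclass (mapM s)) = mapM s.
Proof.
have : s \in Mclass (mapM s) by rewrite inE.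
by move/mem_repr; rewrite inE => /eqP.
Qed.

Theorem theorem3 (n : nat) (hn : (0 < n)%N) (R : comNzRingType) (x q : R) :
  [/\ forall p : n.-tuple step, Mclass p \in Mclasses n -> mapB (Mclass p) = p,
      {in Mclasses n &, injective (@mapB n)},
      [set mapB C | C in Mclasses n] = motzkin_paths n
    & forall C : {set 'S_n}, C \in Mclasses n ->
        \sum_(s in C) perm_weight x q s = path_weight x q (mapB C)].
Proof.
split.
- move=> p /MclassesP[s Ep]; rewrite Ep mapB_Mclass.
  have : s \in Mclass p by rewrite Ep inE.
  by rewrite inE => /eqP.
- move=> _ _ /MclassesP[s ->] /MclassesP[t ->].
  by rewrite !mapB_Mclass => ->.
- apply/setP => p; apply/imsetP/idP => [[_ /MclassesP[s ->] ->]|].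
    by rewrite mapB_Mclass mapM_motzkin.
  case/mapM_onto=> s <-; exists (Mclass (mapM s)); first exact: Mclasses_mapM.
  by rewrite mapB_Mclass.
- move=> _ /MclassesP[s ->]; rewrite mapB_Mclass -sum_class.
    by apply: eq_bigl => t; rewrite inE.
  by have := mapM_motzkin n s; rewrite inE => /andP[/andP[_ /eqP->]].
Qed.
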